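(* Let $\mathcal{A}=\langle Q,\iota,\Sigma,\delta,\alpha\rangle$ be a nondeterministic Büchi automaton, $k=2(|Q|-|\alpha|)$, $\sigma\in\Sigma$, and let $s',o'\in Q_k$ be such that $f_{s'}\le f_{o'}$. Define $f_o:Q\to\mathbb{N}\cup\{\infty\}$ by: for $\ell\in Q$, $f_o(\ell)=\max\big(\{0\}\cup\{h(\ell')\mid \ell'\in\delta(\ell,\sigma)\}\big)$, where $h(\ell')=f_{o'}(\ell')$ if $\ell'\in\alpha$ and $h(\ell')=\min\{f_{o'}(\ell'),\lceil f_{s'}(\ell')\rceil_{odd}\}$ if $\ell'\notin\alpha$; and then, if $\ell\in\alpha$, replace $f_o(\ell)$ by $\lceil f_o(\ell)\rceil_{even}$. Let $L_{\mathsf{Pre}}=\{\langle f_o,f_\emptyset\rangle\}$. If there is $\ell$ with $f_o(\ell)\le k$, define $f_s(\ell)=\max\{f_{s'}(\ell')\mid\ell'\in\delta(\ell,\sigma)\}$ for $\ell\in Q$ (replaced by $\lceil f_s(\ell)\rceil_{even}$ when $\ell\in\alpha$), and add $\langle f_s,f_o\rangle$ to $L_{\mathsf{Pre}}$. Then $[\![L_{\mathsf{Pre}}]\!]=\mathsf{Pre}^{{\sf KVMH}(\mathcal{A})}_\sigma([\![\langle f_{s'},f_{o'}\rangle]\!])$, and for every $\langle f_1,f_2\rangle\in L_{\mathsf{Pre}}$ we have $f_1\le f_2$ and $f_1(\ell)$, $f_2(\ell)$ are even for all $\ell\in\alpha$.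
   Context: An NBW is $\mathcal{A}=\langle Q,\iota,\Sigma,\delta,\alpha\rangle$ with finite state set $Q$, initial state $\iota$, finite alphabet $\Sigma$, $\delta:Q\times\Sigma\to 2^Q$, accepting set $\alpha\subseteq Q$. Let $[k]=\{0,\dots,k\}$, $Q_k=2^{(Q\times[k])\setminus(\alpha\times\mathbb{N}^{odd})}$ ($\mathbb{N}^{odd}$ the odd naturals), $\mathsf{odd}=Q\times[k]^{odd}$. ${\sf KVMH}(\mathcal{A})$ is the NBW with states $Q_k\times Q_k$, initial state $(\{(\iota,k)\},\emptyset)$, accepting states $Q_k\times\{\emptyset\}$, and transitions: if $o\neq\emptyset$, $\delta'(\langle s,o\rangle,\sigma)$ is the set of pairs $\langle s_2,o_2\setminus\mathsf{odd}\rangle$ ($s_2,o_2\in Q_k$) with (i) $o_2\subseteq s_2$; (ii) for all $(\ell,n)\in s$, $\ell'\in\delta(\ell,\sigma)$ there is $n'\le n$ with $(\ell',n')\in s_2$; (iii) for all $(\ell,n)\in o$, $\ell'\in\delta(\ell,\sigma)$ there is $n'\le n$ with $(\ell',n')\in o_2$; if $o=\emptyset$, it is the set of pairs $\langle s_2,s_2\setminus\mathsf{odd}\rangle$ satisfying (ii). For a set $L$ of states, $\mathsf{Pre}^{{\sf KVMH}(\mathcal{A})}_\sigma(L)=\{x\mid\exists y\in L: y\in\delta'(x,\sigma)\}$. For $s\in Q_k$, $f_s(\ell)=\inf\{n\mid(\ell,n)\in s\}$ with $\inf\emptyset=\infty$; $f_\emptyset$ is the constant $\infty$ function; $\infty$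 is treated as larger than every natural number, with $\lceil\infty\rceil_{odd}=\lceil\infty\rceil_{even}=\infty$; $\lceil n\rceil_{odd}$ (resp. $\lceil n\rceil_{even}$) is the least odd (resp. even) number $\ge n$, and $\max\emptyset=0$. For $f,f':Q\to\mathbb{N}\cup\{\infty\}$, $f\le f'$ iff for all $\ell$, $f(\ell)\le f'(\ell)$ or $f'(\ell)>k$. For pairs, $\langle f,g\rangle\le\langle f',g'\rangle$ iff $f\le f'$, $g\le g'$, and ($g=f_\emptyset$ iff $g'=f_\emptyset$). $[\![\langle f,g\rangle]\!]=\{\langle s,o\rangle\in Q_k\times Q_k\mid\langle f,g\rangle\le\langle f_s,f_o\rangle\}$, and $[\![L]\!]=\bigcup_{p\in L}[\![p]\!]$ for a set $L$ of pairs. *)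

(* Defs.v *)
From HB Require Import structures.
From mathcomp Require Import all_boot all_order.
From mathcomp Require Import boolp classical_sets.

Set Implicit Arguments.
Unset Strict Implicit.
Unset Printing Implicit Defensive.

Import Order.TTheory.

Definition enat := option nat.
HB.instance Definition _ := Choice.copy enat (option nat).

Definition fin (n : nat) : enat := Some n.
Definition infty : enat := None.

Definition enat_le (x y : enat) : bool :=
  match x, y with
  | _, None => true
  | None, Some _ => false
  | Some m, Some n => m <= n
  end.

Definition enat_lt (x y : enat) : bool := (y != x) && enat_le x y.
Definition enat_min (x y : enat) : enat := if enat_lt x y then x else y.
Definition enat_max (x y : enat) : enat := if enat_lt x y then y else x.

Lemma enat_le_anti : antisymmetric enat_le.
Proof. by move=> [m|] [n|] //=; rewrite -eqn_leq => /eqP ->. Qed.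

Lemma enat_le_trans : transitive enat_le.
Proof. by move=> [n|] [m|] [p|] //=; apply: leq_trans. Qed.

Lemma enat_le_total : total enat_le.
Proof. by move=> [m|] [n|] //=; apply: leq_total. Qed.

Fact enat_display : Order.disp_t. Proof. exact: Order.Disp tt tt. Qed.

HB.instance Definition _ :=
  Order.isOrder.Build enat_display enat
    (fun _ _ => erefl) (fun _ _ => erefl) (fun _ _ => erefl)
    enat_le_anti enat_le_trans enat_le_total.

Lemma enat_le0x (x : enat) : (fin 0 <= x)%O. Proof. by case: x. Qed.
Lemma enat_lex_infty (x : enat) : (x <= infty)%O. Proof. by case: x. Qed.

HB.instance Definition _ :=
  Order.hasBottom.Build enat_display enat enat_le0x.
HB.instance Definition _ :=
  Order.hasTop.Build enat_display enat enat_lex_infty.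

Definition ceil_odd (x : enat) : enat :=
  if x is Some n then fin (if odd n then n else n.+1) else infty.

Definition ceil_even (x : enat) : enat :=
  if x is Some n then fin (if odd n then n.+1 else n) else infty.

(* Infinity counts as even, in accordance with [ceil_even infty = infty]. *)
Definition eeven (x : enat) : bool := if x is Some n then ~~ odd n else true.

Record nbw (Sigma : finType) := NBW {
  state :> finType;
  init : state;
  delta : state -> Sigma -> {set state};
  acc : {set state}
}.

Arguments init {Sigma} _.
Arguments acc {Sigma} _.

Definition Pre (Sigma : finType) (B : nbw Sigma) (sigma : Sigma)
    (L : set B) : set B :=
  [set x | exists2 y, L y & y \in delta x sigma]%classic.

Section KVMH.
Variables (Sigma : finType) (A : nbw Sigma).

Definition maxrank : nat := 2 * (#|A| - #|acc A|).

Definition ranked : {set A * 'I_maxrank.+1} :=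
  [set x : A * 'I_maxrank.+1 | ~~ ((x.1 \in acc A) && odd x.2)].

Definition odds : {set A * 'I_maxrank.+1} :=
  [set x : A * 'I_maxrank.+1 | odd x.2].

Definition Qk : finType := {s : {set A * 'I_maxrank.+1} | s \subset ranked}.

Lemma kvmh_init_subproof : [set (init A, @ord_max maxrank)] \subset ranked.
Proof. by rewrite finset.sub1set inE /= /maxrank oddM andbF. Qed.

Lemma empty_subproof : (finset.set0 : {set A * 'I_maxrank.+1}) \subset ranked.
Proof. exact: finset.sub0set. Qed.

Definition Qk_init : Qk := Sub _ kvmh_init_subproof.
Definition Qk0 : Qk := Sub _ empty_subproof.

Definition covers (sigma : Sigma) (s s2 : Qk) : bool :=
  [forall x in val s, forall l' in delta x.1 sigma,
    exists n' : 'I_maxrank.+1, (n' <= x.2) && ((l', n') \in val s2)].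

Definition kvmh_delta (x : Qk * Qk) (sigma : Sigma) : {set Qk * Qk} :=
  let: (s, o) := x in
  if o != Qk0 then
    [set y : Qk * Qk | [exists o2 : Qk,
      [&& val y.2 == val o2 :\: odds,
          val o2 \subset val y.1,
          covers sigma s y.1
        & covers sigma o o2]]]
  else
    [set y : Qk * Qk |
      (val y.2 == val y.1 :\: odds) && covers sigma s y.1].

Definition KVMH : nbw Sigma :=
  @NBW Sigma (Qk * Qk)%type (Qk_init, Qk0) kvmh_delta
    [set x : Qk * Qk | x.2 == Qk0].

Definition rankf (s : Qk) (l : A) : enat :=
  (\big[Order.min/infty]_(n < maxrank.+1 | (l, n) \in val s) fin n)%O.

Definition f_empty : A -> enat := fun=> infty.

Definition rle (f f' : A -> enat) : Prop :=
  forall l, (f l <= f' l)%O \/ (fin maxrank < f' l)%O.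

Definition ple (p p' : (A -> enat) * (A -> enat)) : Prop :=
  [/\ rle p.1 p'.1, rle p.2 p'.2 & p.2 = f_empty <-> p'.2 = f_empty].

Definition sem1 (p : (A -> enat) * (A -> enat)) : set KVMH :=
  [set x : Qk * Qk | ple p (rankf x.1, rankf x.2)]%classic.

Definition sem (L : set ((A -> enat) * (A -> enat))) : set KVMH :=
  (\bigcup_(p in L) sem1 p)%classic.

Definition even_on_acc (f : A -> enat) (l : A) : enat :=
  if l \in acc A then ceil_even (f l) else f l.

(* The convention is that the maximum of the empty set is zero, so the explicit
   {0} in the definition of f_o needs no separate treatment. *)
Definition max_succ (sigma : Sigma) (h : A -> enat) (l : A) : enat :=
  (\big[Order.max/fin 0]_(l' in delta l sigma) h l')%O.

Definition pre_o (sigma : Sigma) (fs' fo' : A -> enat) : A -> enat :=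
  even_on_acc (max_succ sigma (fun l' =>
    if l' \in acc A then fo' l'
    else Order.min (fo' l') (ceil_odd (fs' l')))).

Definition pre_s (sigma : Sigma) (fs' : A -> enat) : A -> enat :=
  even_on_acc (max_succ sigma fs').

Definition LPre (sigma : Sigma) (fs' fo' : A -> enat) :
    set ((A -> enat) * (A -> enat)) :=
  let fo := pre_o sigma fs' fo' in
  let fs := pre_s sigma fs' in
  [set p | p = (fo, f_empty) \/
           (exists l, (fo l <= fin maxrank)%O) /\ p = (fs, fo)]%classic.

End KVMH.

Arguments f_empty {Sigma} A.

(* Main.v *)
(** A set [s] of ranked states satisfies [f <= f_s] exactly when every
    [(l, n)] in [s] has [f l <= n].  Among the targets above [<f_s', f_o'>] there
    is therefore a largest one: its main component is the set of pairs above
    [f_s'], and its obligation component, before the odd ranks are removed,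
    consists of the even ranks above [f_o'] and of the odd ranks above [f_s'].
    The least rank of the latter at [l'] is [h l'], and transitions are monotone
    in the target, so a state is a predecessor iff it can reach that largest
    target, which amounts to bounding its ranks below by the maxima of [f_s']
    and of [h] over successors. *)
Require Import Defs.
From mathcomp Require Import all_boot all_order.
From mathcomp Require Import boolp classical_sets.

Set Implicit Arguments.
Unset Strict Implicit.
Unset Printing Implicit Defensive.

Import Order.TTheory.

(** * Rounding to odd and even ranks *)

Lemma le_ceil_odd (x : enat) : (x <= ceil_odd x)%O.
Proof. by case: x => [n|] //=; rewrite /Order.le /=; case: ifP. Qed.

(** An even [x] never equals an odd bound, so rounding it up by one cannot cross the bound. *)
Lemma ceil_odd_le (x : enat) (n : nat) :
  odd n -> (ceil_odd x <= fin n)%O = (x <= fin n)%O.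
Proof.
case: x => [m|] // on; rewrite /Order.le /=; case: ifP => // em.
by rewrite [RHS]leq_eqVlt; case: eqP em on => [->->|].
Qed.

Lemma ceil_even_le (x : enat) (n : nat) :
  ~~ odd n -> (ceil_even x <= fin n)%O = (x <= fin n)%O.
Proof.
case: x => [m|] // en; rewrite /Order.le /=; case: ifP => // om.
by rewrite [RHS]leq_eqVlt; case: eqP om en => [->->|].
Qed.

Lemma ceil_even_homo (x y : enat) : (x <= y)%O -> (ceil_even x <= ceil_even y)%O.
Proof.
case: y => [n|] //; first last. by case: x.
case: x => [m|] //; rewrite {1}/Order.le /= => mn.
have le_n : (fin m <= ceil_even (fin n))%O.
  by rewrite /Order.le /=; case: ifP => // _; apply: leqW.
have en : ~~ odd (if odd n then n.+1 else n) by case: ifP => /= ->.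
by rewrite (ceil_even_le (fin m) en).
Qed.

Lemma eeven_ceil_even (x : enat) : eeven (ceil_even x).
Proof. by case: x => [n|] //=; case: ifP => /= ->. Qed.

(** * Lower bounds on the ranks of a set *)

Section Predecessors.
Variables (Sigma : finType) (A : nbw Sigma).
Implicit Types (s o : Qk A) (f g h : A -> enat) (l : A).
Local Notation rank := 'I_(maxrank A).+1.

Lemma odd_maxrank : odd (maxrank A) = false.
Proof. by rewrite /maxrank oddM. Qed.

Lemma rankf_leP s l (n : nat) :
  reflect (exists2 m : rank, m <= n & (l, m) \in val s) (rankf s l <= fin n)%O.
Proof.
apply: (iffP idP) => [|[m mn ms]]; last first.
  by rewrite /rankf; apply: (@bigmin_inf _ _ _ _ m).
rewrite /rankf; apply: contraPP => nex; apply/negP; rewrite -ltNge.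
apply/bigmin_gtP; split=> // m ms.
by rewrite ltNge; apply/negP => mn; apply: nex; exists m.
Qed.

(** Ranks in [s] are at most [maxrank A], so the second alternative of [rle] holds only at states
    without a rank, where the right-hand side asks nothing. *)
Lemma rle_rankfP f s :
  rle f (rankf s) <-> (forall l (n : rank), (l, n) \in val s -> (f l <= fin n)%O).
Proof.
split=> [fs l n ns | fs l].
  have le_n : (rankf s l <= fin n)%O by apply/rankf_leP; exists n.
  case: (fs l) => [le_f|]; first exact: le_trans le_f le_n.
  move=> /lt_le_trans /(_ le_n); rewrite ltNge; case/negP.
  by rewrite /Order.le /= -ltnS.
left; case E: (rankf s l) => [m|]; last exact: lex1.
have /rankf_leP[n nm ns]: (rankf s l <= fin m)%O by rewrite E.
exact: le_trans (fs l n ns) _.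
Qed.

Lemma rle_rankf_le f s l : rle f (rankf s) -> (f l <= rankf s l)%O.
Proof.
move/rle_rankfP=> fs; case E: (rankf s l) => [m|]; last exact: lex1.
have /rankf_leP[n nm ns]: (rankf s l <= fin m)%O by rewrite E.
exact: le_trans (fs l n ns) _.
Qed.

Lemma rankf_emptyP s : rankf s = f_empty A <-> s = Qk0 A.
Proof.
split=> [s0 | ->].
  apply/val_inj/finset.setP => -[l n]; rewrite inE; apply/negP => ns.
  have: (rankf s l <= fin n)%O by apply/rankf_leP; exists n.
  by rewrite s0.
apply/funext => l; rewrite /rankf big_pred0 // => n.
by rewrite inE.
Qed.

Lemma Qk_even s l (n : rank) : (l, n) \in val s -> l \in acc A -> ~~ odd n.
Proof.
by move/(fintype.subsetP (valP s)); rewrite inE /= => + la; rewrite la.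
Qed.

(** Accepting states carry only even ranks in [s], and rounding up to even does not change a
    comparison with an even bound. What remains is that a maximum is bounded iff all its terms
    are. *)
Lemma rle_even_on_acc_max_succP (sigma : Sigma) h s :
  rle (even_on_acc (max_succ sigma h)) (rankf s) <->
  (forall l (n : rank), (l, n) \in val s ->
     forall l', l' \in delta l sigma -> (h l' <= fin n)%O).
Proof.
have maxP l (n : rank) : (l, n) \in val s ->
    (even_on_acc (max_succ sigma h) l <= fin n)%O =
    (max_succ sigma h l <= fin n)%O.
  rewrite /even_on_acc; case: ifP => // la ns.
  exact: ceil_even_le (Qk_even ns la).
split=> [/rle_rankfP hs l n ns | hs].
  by move: (hs l n ns); rewrite maxP // => /bigmax_leP[].
apply/rle_rankfP => l n ns; rewrite maxP //.
by apply/bigmax_leP; split=> // l'; apply: hs ns _.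
Qed.

Lemma coversP (sigma : Sigma) s s2 :
  reflect (forall l (n : rank), (l, n) \in val s ->
             forall l', l' \in delta l sigma -> (rankf s2 l' <= fin n)%O)
          (covers sigma s s2).
Proof.
apply: (iffP idP) => [cov l n ns l' l'd | cov].
  have /forall_inP/(_ _ ns)/forall_inP/(_ _ l'd)/existsP[m /andP[mn ms]] := cov.
  by apply/rankf_leP; exists m.
apply/forall_inP => -[l n] ns; apply/forall_inP => l' l'd.
have /rankf_leP[m mn ms] := cov l n ns l' l'd.
by apply/existsP; exists m; rewrite mn.
Qed.

(** * The largest target *)

Lemma Qk_restrict_subproof (P : pred (A * rank)) :
  [set x in ranked A | P x] \subset ranked A.
Proof. by apply/fintype.subsetP => x; rewrite inE => /andP[]. Qed.

Definition Qk_restrict (P : pred (A * rank)) : Qk A :=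
  Sub _ (Qk_restrict_subproof P).

Lemma in_Qk_restrict (P : pred (A * rank)) x :
  (x \in val (Qk_restrict P)) = (x \in ranked A) && P x.
Proof. by rewrite inE. Qed.

Lemma Qk_setD_odds_subproof s : val s :\: odds A \subset ranked A.
Proof. exact: fintype.subset_trans (finset.subsetDl _ _) (valP s). Qed.

Definition Qk_even_part s : Qk A := Sub _ (Qk_setD_odds_subproof s).

Lemma in_Qk_even_part s l (n : rank) :
  ((l, n) \in val (Qk_even_part s)) = ~~ odd n && ((l, n) \in val s).
Proof. by rewrite !inE. Qed.

Section Target.
Variables (s' o' : Qk A).
Hypothesis hso : rle (rankf s') (rankf o').

(** This is [h] of the statement, convertible with the function written inside [pre_o]. *)
Definition succ_bound (l' : A) : enat :=
  if l' \in acc A then rankf o' l'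
  else Order.min (rankf o' l') (ceil_odd (rankf s' l')).

Definition max_state : Qk A :=
  Qk_restrict [pred x : A * rank | (rankf s' x.1 <= fin x.2)%O].

Definition max_obligation : Qk A :=
  Qk_restrict [pred x : A * rank |
    ((if odd x.2 then rankf s' x.1 else rankf o' x.1) <= fin x.2)%O].

Lemma rankf_le_succ_bound l : (rankf s' l <= succ_bound l)%O.
Proof.
have so := rle_rankf_le l hso; rewrite /succ_bound; case: ifP => // _.
by rewrite le_min so le_ceil_odd.
Qed.

(** An even rank in [o2] survives the removal of [odds], hence lies above [rankf o']. An odd one
    belongs to a non-accepting state and, being above [rankf s'], is also above its odd ceiling. *)
Lemma succ_bound_le o2 l (n : nat) :
  rle (rankf s') (rankf o2) -> rle (rankf o') (rankf (Qk_even_part o2)) ->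
  (rankf o2 l <= fin n)%O -> (succ_bound l <= fin n)%O.
Proof.
move=> /rle_rankfP so2 /rle_rankfP oo2 /rankf_leP[m mn ms].
apply: (@le_trans _ _ (fin m)) => //; rewrite /succ_bound.
case: (boolP (odd m)) => om.
  case: ifP => la; first by have := Qk_even ms la; rewrite om.
  by rewrite ge_min ceil_odd_le // so2 // orbT.
have le_o : (rankf o' l <= fin m)%O by apply: oo2; rewrite in_Qk_even_part om.
by case: ifP => // _; rewrite ge_min le_o.
Qed.

Lemma rankf_max_state_le l (n : rank) :
  (rankf s' l <= fin n)%O -> (rankf max_state l <= fin n)%O.
Proof.
move=> /rankf_leP[m mn ms]; apply/rankf_leP; exists m => //.
rewrite in_Qk_restrict (fintype.subsetP (valP s')) //=.
by apply/rankf_leP; exists m.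
Qed.

Lemma rankf_max_obligation_le l (n : rank) :
  (succ_bound l <= fin n)%O -> (rankf max_obligation l <= fin n)%O.
Proof.
have so := rle_rankf_le l hso.
have from_o : (rankf o' l <= fin n)%O -> (rankf max_obligation l <= fin n)%O.
  case/rankf_leP=> m mn ms; apply/rankf_leP; exists m => //.
  rewrite in_Qk_restrict (fintype.subsetP (valP o')) //=.
  have le_m : (rankf o' l <= fin m)%O by apply/rankf_leP; exists m.
  (* The rank [m] from [o'] may be odd; it must then lie above [rankf s'], which [so] gives. *)
  by case: ifP => // _; apply: le_trans le_m.
rewrite /succ_bound; case: ifP => // la; rewrite ge_min => /orP[//|].
case E: (rankf s' l) => [m|] //= mn.
(* The witness is the odd ceiling of the rank in [s']. It is at most [n], hence in range, and an odd
   rank is admissible because [l] is not accepting. *)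
set c := if odd m then m else m.+1 in mn.
have ltc : c < (maxrank A).+1 by apply: leq_ltn_trans (ltn_ord n).
have oc : odd c by rewrite /c; case: ifP => //= ->.
apply/rankf_leP; exists (Ordinal ltc) => //.
rewrite in_Qk_restrict !inE /= la oc /= E.
exact: le_ceil_odd (fin m).
Qed.

Lemma rle_max_state : rle (rankf s') (rankf max_state).
Proof. by apply/rle_rankfP => l n; rewrite in_Qk_restrict => /andP[]. Qed.

Lemma max_obligation_sub : val max_obligation \subset val max_state.
Proof.
apply/fintype.subsetP => -[l n]; rewrite !in_Qk_restrict => /andP[-> /=].
by case: ifP => // _; apply: le_trans (rle_rankf_le l hso).
Qed.

Lemma rle_max_obligation : rle (rankf s') (rankf max_obligation).
Proof.
have /rle_rankfP le_s := rle_max_state.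
by apply/rle_rankfP => l n /(fintype.subsetP max_obligation_sub); apply: le_s.
Qed.

Lemma rle_max_obligation_even :
  rle (rankf o') (rankf (Qk_even_part max_obligation)).
Proof.
apply/rle_rankfP => l n; rewrite in_Qk_even_part in_Qk_restrict.
by case/and3P => /= /negbTE->.
Qed.

(* [k] is even, so a state with an obligation in [o'] keeps the rank [k]. *)
Lemma max_obligation_even_empty :
  rankf o' = f_empty A <-> rankf (Qk_even_part max_obligation) = f_empty A.
Proof.
split=> [o0 | /rankf_emptyP e0].
  apply/rankf_emptyP/val_inj/finset.setP => -[l n]; rewrite in_Qk_even_part.
  rewrite in_Qk_restrict !inE /= o0.
  by apply/and3P => -[/negbTE->].
apply/rankf_emptyP/val_inj/finset.setP => -[l n].
rewrite [RHS]inE; apply/negP => no.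
have : (l, @ord_max (maxrank A)) \in val (Qk_even_part max_obligation).
  rewrite in_Qk_even_part in_Qk_restrict !inE /= odd_maxrank andbF /=.
  by apply/rankf_leP; exists n => //; rewrite -ltnS.
by rewrite e0 inE.
Qed.

(** The main component stays free: it is [max_obligation] when the source has no obligation, and
    [max_state] otherwise. *)
Lemma ple_max_obligation s2 :
  rle (rankf s') (rankf s2) ->
  sem1 (rankf s', rankf o') (s2, Qk_even_part max_obligation).
Proof.
split=> //=; [exact: rle_max_obligation_even|exact: max_obligation_even_empty].
Qed.

Lemma covers_max_obligation (sigma : Sigma) s :
  rle (pre_o sigma (rankf s') (rankf o')) (rankf s) ->
  covers sigma s max_obligation.
Proof.
move/rle_even_on_acc_max_succP => hs; apply/coversP => l n ns l' l'd.
exact/rankf_max_obligation_le/(hs l n ns).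
Qed.

(** Serves both kinds of transition: [s] is the source obligation, or the main component when that
    obligation is empty and [o2] is the whole new main component. *)
Lemma rle_pre_o (sigma : Sigma) s o2 :
  rle (rankf s') (rankf o2) -> rle (rankf o') (rankf (Qk_even_part o2)) ->
  covers sigma s o2 -> rle (pre_o sigma (rankf s') (rankf o')) (rankf s).
Proof.
move=> so2 oo2 /coversP cov; apply/rle_even_on_acc_max_succP => l n ns l' l'd.
exact: succ_bound_le so2 oo2 (cov l n ns l' l'd).
Qed.

Lemma rle_pre_s (sigma : Sigma) s s2 :
  rle (rankf s') (rankf s2) -> covers sigma s s2 ->
  rle (pre_s sigma (rankf s')) (rankf s).
Proof.
move=> ss2 /coversP cov; apply/rle_even_on_acc_max_succP => l n ns l' l'd.
exact: le_trans (rle_rankf_le l' ss2) (cov l n ns l' l'd).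
Qed.

Lemma covers_max_state (sigma : Sigma) s :
  rle (pre_s sigma (rankf s')) (rankf s) -> covers sigma s max_state.
Proof.
move/rle_even_on_acc_max_succP => hs; apply/coversP => l n ns l' l'd.
exact/rankf_max_state_le/(hs l n ns).
Qed.

Lemma pre_s_le_pre_o (sigma : Sigma) l :
  (pre_s sigma (rankf s') l <= pre_o sigma (rankf s') (rankf o') l)%O.
Proof.
have le_max : (max_succ sigma (rankf s') l <= max_succ sigma succ_bound l)%O.
  apply/bigmax_leP; split=> [|l' l'd]; first exact: enat_le0x.
  exact: le_trans (rankf_le_succ_bound l') (le_bigmax_cond _ _ l'd).
rewrite /pre_s /pre_o /even_on_acc; case: ifP => // _.
exact: ceil_even_homo.
Qed.

(** * Transitions and the two inclusions *)

Lemma kvmh_delta_Qk0P (sigma : Sigma) s (y : Qk A * Qk A) :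
  reflect (y.2 = Qk_even_part y.1 /\ covers sigma s y.1)
          (y \in kvmh_delta (s, Qk0 A) sigma).
Proof.
rewrite /kvmh_delta eqxx inE.
apply: (iffP andP) => [[/eqP e c] | [-> c]]; split=> //.
exact: val_inj.
Qed.

Lemma kvmh_deltaP (sigma : Sigma) s o (y : Qk A * Qk A) : o <> Qk0 A ->
  reflect (exists o2, [/\ y.2 = Qk_even_part o2, val o2 \subset val y.1,
             covers sigma s y.1 & covers sigma o o2])
          (y \in kvmh_delta (s, o) sigma).
Proof.
move/eqP=> o0; rewrite /kvmh_delta o0 inE.
apply: (iffP existsP) => -[o2]; last by case=> -> *; exists o2; apply/and4P.
by case/and4P=> /eqP e *; exists o2; split=> //; apply: val_inj.
Qed.

Lemma sem_LPre (sigma : Sigma) :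
  sem (LPre sigma (rankf s') (rankf o')) =
  Pre sigma (sem1 (rankf s', rankf o')).
Proof.
apply/seteqP; split=> [[s o]|[s o]].
  case=> p [-> [/= fo _ e0] | [[l fol] ->] [/= fs fo e0]].
    have /rankf_emptyP -> : rankf o = f_empty A by apply: (iffLR e0).
    (* From an empty obligation the new one is the even part of the whole main component, so the
       main component is itself chosen as [max_obligation]. *)
    exists (max_obligation, Qk_even_part max_obligation).
      exact: ple_max_obligation rle_max_obligation.
    by apply/kvmh_delta_Qk0P; split=> //; apply: covers_max_obligation.
  (* The finite value of [pre_o] at [l] rules out [f_empty], hence an empty [o]. *)
  have o0 : o <> Qk0 A.
    by move/rankf_emptyP/(iffRL e0) => fo0; rewrite fo0 in fol.
  exists (max_state, Qk_even_part max_obligation).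
    exact: ple_max_obligation rle_max_state.
  apply/kvmh_deltaP => //; exists max_obligation.
  split=> //; first exact: max_obligation_sub.
    exact: covers_max_state.
  exact: covers_max_obligation.
case=> -[s2 o2'] /= [/= ss2 oo2 _].
have [-> | o0] := pselect (o = Qk0 A).
  case/kvmh_delta_Qk0P=> /= e c; rewrite e in oo2.
  exists (pre_o sigma (rankf s') (rankf o'), f_empty A); first by left.
  have e0 : rankf (Qk0 A) = f_empty A by apply/rankf_emptyP.
  split=> /=; first exact: rle_pre_o ss2 oo2 c.
    by rewrite e0 => l; left.
  by rewrite e0.
case/kvmh_deltaP=> // o2 /= [e sub cs co]; rewrite e in oo2.
(* The odd ranks of [o2] escape [oo2]; they are bounded only through the inclusion in [s2]. *)
have so2 : rle (rankf s') (rankf o2).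
  by apply/rle_rankfP => l n /(fintype.subsetP sub); move: l n; apply/rle_rankfP.
have fo := rle_pre_o so2 oo2 co.
(* Any pair in the nonempty [o] bounds [pre_o] at its state by a rank at most [maxrank A], so the
   second pair does belong to [LPre]. *)
have [l fol] : exists l, (pre_o sigma (rankf s') (rankf o') l
                          <= fin (maxrank A))%O.
  have [o_empty | [[l n] ln]] := finset.set_0Vmem (val o).
    by case: o0; apply: val_inj.
  exists l; apply: (le_trans (iffLR (rle_rankfP _ _) fo l n ln)).
  by rewrite /Order.le /= -ltnS.
exists (pre_s sigma (rankf s'), pre_o sigma (rankf s') (rankf o')).
  by right; split=> //; exists l.
split=> //=; first exact: rle_pre_s ss2 cs.
split=> [fo0 | /rankf_emptyP //].
by rewrite fo0 in fol.
Qed.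

End Target.
End Predecessors.

Theorem theorem5p4 (Sigma : finType) (A : nbw Sigma) (sigma : Sigma)
    (s' o' : Qk A) (hso : rle (rankf s') (rankf o')) :
  sem (LPre sigma (rankf s') (rankf o'))
    = Pre sigma (sem1 (rankf s', rankf o'))
  /\ (forall f1 f2 : A -> enat,
        LPre sigma (rankf s') (rankf o') (f1, f2) ->
        rle f1 f2 /\
        forall l : A, l \in acc A -> eeven (f1 l) /\ eeven (f2 l)).
Proof.
split=> [|f1 f2]; first exact: sem_LPre.
have even_pre h l : l \in acc A -> eeven (even_on_acc h l).
  by rewrite /even_on_acc => ->; apply: eeven_ceil_even.
case=> [[-> ->] | [_ [-> ->]]]; split=> l.
(* [f_empty] exceeds [maxrank A] everywhere. *)
- by right.
- by split=> //; apply: even_pre.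
- by left; apply: pre_s_le_pre_o.
- by split; apply: even_pre.
Qed.
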